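(* There is an absolute constant $C>0$ such that for all positive integers $n$ and $r$ the following holds. For every input of online Min-Sum Set Cover over a universe of $n$ elements whose requested sets have cardinality at most $r$, and for every offline algorithm $\mathrm{Off}$ that keeps one fixed permutation throughout (of its own choosing, possibly different from the initial permutation $\pi_0$), we have $$\mathrm{DLM}(\mathcal I)\le C\, r\cdot \mathrm{Off}(\mathcal I)+\xi,$$ where $\xi$ does not depend on the request sequence. In other words, DLM is $O(r)$-competitive in the static scenario.
   Context: Online Min-Sum Set Cover (MSSC). Let $\mathcal U$ be a universe of $n$ elements. A permutation is a bijection $\pi:\mathcal U\to\{1,\dots,n\}$, where $\pi(z)$ is the list position of $z$. An input $\mathcal I$ consists of an initial permutation $\pi_0$ and a sequence of nonempty sets $R_1,\dots,R_m\subseteq\mathcal U$, each of cardinality at most $r$. In step $t$, an algorithm holding permutation $\pi_{t-1}$ is shown $R_t$ and pays the access cost $\min_{z\in R_t}\pi_{t-1}(z)$. It then picks a new permutation $\pi_t$ and pays the reordering cost $d(\pi_{t-1},\pi_t)$, which is the minimum number of swaps of adjacent elements turning $\pi_{t-1}$ into $\pi_t$. An online algorithm chooses $\pi_t$ without knowing future requests or $m$. $A(\mathcal I)$ denotes the total cost of algorithm $A$ on $\mathcal I$. The static scenario compares an online algorithm, which starts from $\pi_0$, with offline algorithms that use a single fixed permutation for the whole input and pay only access costs. Algorithm DLM. Every element $z$ has a budget $b(z)$, initially $0$. The operation fetch$(z)$ moves $z$ to position 1 by $\pi(z)-1$ adjacent swaps, so every element that preceded $z$ moves back by one position, and then sets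 $b(z)\gets 0$. On a request $R$ with $|R|=s$, let $x\in R$ be the element of $R$ with the smallest current position and let $\ell=\pi(x)$. DLM pays access cost $\ell$ and executes fetch$(x)$. For every $y\in R\setminus\{x\}$ it sets $b(y)\gets b(y)+\ell/s$. Finally, while some element $z$ has $b(z)\ge \pi(z)$, it executes fetch$(z)$ for such a $z$. *)

(* Defs.v *)
From HB Require Import structures.
From mathcomp Require Import all_boot all_order all_algebra.
From mathcomp Require Import zify.

Set Implicit Arguments.
Unset Strict Implicit.
Unset Printing Implicit Defensive.

Import Order.TTheory GRing.Theory Num.Theory.

Section Listings.

Variable U : finType.
Implicit Types (f : {ffun U -> nat}) (x y z : U).

(* An injection of [U] into {1, ..., #|U|} is automatically a bijection
   (see [listing_onto]). *)
Definition is_listing f := injectiveb f && [forall z, 0 < f z <= #|U|].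

Record listing := Listing { pos :> {ffun U -> nat}; _ : is_listing pos }.

HB.instance Definition _ := [isSub for pos].
HB.instance Definition _ := [Equality of listing by <:].

Implicit Types (pi sigma : listing).

Lemma listing_inj pi : injective pi.
Proof. by case: pi => f /= /andP[/injectiveP]. Qed.

Lemma listing_bounds pi z : 0 < pi z <= #|U|.
Proof. by case: pi => f /= /andP[_ /forallP]. Qed.

Lemma listing_onto pi j : 0 < j <= #|U| -> exists z, pi z = j.
Proof.
move=> j_bnd; have Uc : uniq (codom pi) by apply/injectiveP/listing_inj.
have sub : {subset codom pi <= iota 1 #|U|}.
  move=> _ /codomP[z ->]; rewrite mem_iota.
  by have := listing_bounds pi z; lia.
have [|_ eqm] := uniq_min_size Uc sub; first by rewrite size_codom size_iota.
have : j \in codom pi by rewrite eqm mem_iota; lia.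
by case/codomP=> z ->; exists z.
Qed.

(* Exchange of the elements at the adjacent positions [i.+1] and [i.+2]. *)
Definition adj_fun (i : nat) f : {ffun U -> nat} :=
  [ffun z => if f z == i.+1 then i.+2 else if f z == i.+2 then i.+1 else f z].

Lemma adj_subproof pi (i : 'I_#|U|.-1) : is_listing (adj_fun i pi).
Proof.
apply/andP; split.
  apply/injectiveP => y z; rewrite !ffunE => e; apply: (@listing_inj pi).
  by move: e; do !case: eqP; lia.
apply/forallP => z; rewrite ffunE; have := listing_bounds pi z.
by have := ltn_ord i; do !case: eqP; lia.
Qed.

Definition adj_swap pi (i : 'I_#|U|.-1) : listing :=
  Listing (adj_subproof pi i).

Definition reachable_in pi sigma (k : nat) : bool :=
  [exists s : k.-tuple 'I_#|U|.-1, foldl adj_swap pi s == sigma].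

Lemma reachable pi sigma : exists k, reachable_in pi sigma k.
Proof.
suff [s <-] : exists s, foldl adj_swap pi s = sigma.
  by exists (size s); apply/existsP; exists (in_tuple s).
have: forall w, #|U| < sigma w -> pi w = sigma w.
  by move=> w; have := listing_bounds sigma w; lia.
have: #|U| <= #|U| by [].
move: {1 3}#|U| => k; elim: k pi => [|k IHk] pi k_le agree.
  exists [::]; apply/val_inj/ffunP => w /=; apply: agree.
  by have := listing_bounds sigma w; lia.
have [z sz] : exists z, sigma z = k.+1 by apply: listing_onto; lia.
have [m] := ubnP (k.+1 - pi z); elim: m => // m IHm in pi agree *; move=> lt_m.
have pz_le : pi z <= k.+1.
  rewrite leqNgt; apply/negP => pz_gt.
  have [|w sw] := @listing_onto sigma (pi z).
    by have := listing_bounds pi z; lia.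
  have /listing_inj wz : pi w = pi z by rewrite agree sw.
  by move: sw sz; rewrite wz; lia.
have [pz|pz_neq] := eqVneq (pi z) k.+1.
  apply: IHk => [|w lt_w]; first by lia.
  have [sw|sw_neq] := eqVneq (sigma w) k.+1; last by apply: agree; lia.
  have <- : z = w by apply: (@listing_inj sigma); rewrite sz sw.
  by rewrite pz sz.
have lt_i : (pi z).-1 < #|U|.-1 by have := listing_bounds pi z; lia.
have pz_gt0 := listing_bounds pi z.
have [||s <-] := IHm (adj_swap pi (Ordinal lt_i)).
- move=> w lt_w; rewrite /= ffunE /= (agree _ lt_w).
  by do !case: eqP; lia.
- by rewrite /= ffunE /=; do !case: eqP; lia.
by exists (Ordinal lt_i :: s).
Qed.

Definition dist pi sigma : nat := ex_minn (reachable pi sigma).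

(* Positions never exceed [#|U|], so the default value [#|U|] does not affect
   the minimum over a nonempty [R]. *)
Definition access (R : {set U}) pi : nat := \big[minn/#|U|]_(z in R) pi z.

(* [pis] lists the permutations held after each of the requests [Rs]; each
   step is charged the distance between the permutations before and after it,
   which may be smaller than the number of swaps performed in between. *)
Fixpoint total_cost pi (Rs : seq {set U}) (pis : seq listing) : nat :=
  match Rs, pis with
  | R :: Rs', pi' :: pis' =>
      access R pi + dist pi pi' + total_cost pi' Rs' pis'
  | _, _ => 0
  end.

Definition static_cost sigma (Rs : seq {set U}) : nat :=
  \sum_(R <- Rs) access R sigma.

Definition fetch_fun z f : {ffun U -> nat} :=
  [ffun y => if y == z then 1 else if f y < f z then (f y).+1 else f y].

Lemma fetch_subproof z pi : is_listing (fetch_fun z pi).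
Proof.
have bnd := listing_bounds pi; have bndz := bnd z; apply/andP; split.
  apply/injectiveP => x y; rewrite !ffunE.
  have inj a b : a <> b -> pi a <> pi b by move=> ab /listing_inj.
  have [-> | /eqP/inj xz] := eqVneq x z; have [-> | /eqP/inj yz] := eqVneq y z => //.
  - by have := bnd y => ? e; exfalso; move: e; case: ltnP; lia.
  - by have := bnd x => ? e; exfalso; move: e; case: ltnP; lia.
  move=> e; apply: (@listing_inj pi); move: e.
  by case: (ltnP (pi x)); case: (ltnP (pi y)); lia.
apply/forallP => y; rewrite ffunE; have := bnd y.
by case: eqP => _; [lia | case: (ltnP (pi y)); lia].
Qed.

Definition fetch_listing z pi : listing := Listing (fetch_subproof z pi).

Local Open Scope ring_scope.

Definition state : Type := (listing * {ffun U -> rat})%type.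

Implicit Types st : state.

Definition fetch z st : state :=
  (fetch_listing z st.1, [ffun y => if y == z then 0 else st.2 y]).

(* [l] is the position of [x] before [x] was fetched. *)
Definition charge (R : {set U}) x (l : nat) st : state :=
  (st.1, [ffun y => if y \in R :\ x then st.2 y + l%:R / #|R|%:R else st.2 y]).

(* The element fetched at each iteration is arbitrary among the eligible
   ones, so the algorithm is a relation between states. *)
Inductive dlm_loop : state -> state -> Prop :=
| dlm_loop_stop (st : state) :
    (forall z, st.2 z < (st.1 z)%:R) -> dlm_loop st st
| dlm_loop_fetch (st st' : state) z :
    (st.1 z)%:R <= st.2 z -> dlm_loop (fetch z st) st' -> dlm_loop st st'.

Definition dlm_step st (R : {set U}) (st' : state) : Prop :=
  exists x, [/\ x \in R, (forall y, y \in R -> (st.1 x <= st.1 y)%N)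
              & dlm_loop (charge R x (st.1 x) (fetch x st)) st'].

Inductive dlm_run : state -> seq {set U} -> seq listing -> Prop :=
| dlm_run_nil (st : state) : dlm_run st [::] [::]
| dlm_run_cons (st st' : state) R Rs pis :
    dlm_step st R st' -> dlm_run st' Rs pis ->
    dlm_run st (R :: Rs) (st'.1 :: pis).

Definition dlm_init pi0 : state := (pi0, [ffun=> 0]).

Lemma dlm_loop_total st : exists st', dlm_loop st st'.
Proof.
have [m] := ubnP #|[set z | (st.1 z)%:R <= st.2 z]|.
elim: m st => // m IHm st lt_m.
have [/existsP[z elig]|none] := boolP [exists z, (st.1 z)%:R <= st.2 z]; last first.
  exists st; apply: dlm_loop_stop => z; rewrite ltNge.
  by move: none; rewrite negb_exists => /forallP.
have [|st' run] := IHm (fetch z st); last by exists st'; apply: dlm_loop_fetch run.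
rewrite -ltnS; apply: leq_trans lt_m; rewrite ltnS.
apply: proper_card; apply/properP; split; last first.
  by exists z; rewrite !inE //= !ffunE eqxx -ltNge ltr01.
apply/subsetP => y; rewrite !inE /= !ffunE.
case: eqP => [_|_]; first by rewrite leNgt ltr01.
by apply: le_trans; rewrite ler_nat; case: ltnP.
Qed.

(* Every input has a run, so statements about all runs are not vacuous. *)
Lemma dlm_run_total st (Rs : seq {set U}) :
  all (fun R => R != set0) Rs -> exists pis, dlm_run st Rs pis.
Proof.
elim: Rs st => [|R Rs IH] st /=; first by exists [::]; constructor.
case/andP => /set0Pn[x0 x0R] /IH{}IH.
have [x xR x_min] := @arg_minnP _ x0 (fun z => z \in R) (fun z => st.1 z) x0R.
have [st' loop] := dlm_loop_total (charge R x (st.1 x) (fetch x st)).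
have [pis run] := IH st'; exists (st'.1 :: pis).
by apply: dlm_run_cons run; exists x.
Qed.

End Listings.

(* Main.v *)
Require Import Defs.
From mathcomp Require Import all_boot all_order all_algebra.
From mathcomp Require Import zify lra.
Set Implicit Arguments.
Unset Strict Implicit.
Unset Printing Implicit Defensive.
Import Order.TTheory GRing.Theory Num.Theory.
Local Open Scope ring_scope.

(** Let [m = 30 r].  An element [z] has excess
    [max 0 (3 (pi z - m sigma z) - b z)], and the potential is
    [2 (sum of the budgets) + 10 r (sum of the excesses)].  An element [y]
    before [z] can gain excess when [z] is fetched only if [m sigma y <= pi z], and
    there are at most [pi z / m] such [y]; so a fetch of [z] raises the second
    term by at most [pi z], which the budget [b z >= pi z] pays for together
    with the swaps.  On a request of access cost [l], let [w] be the requested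
    element that is first in [sigma].  Either [l <= 2 m sigma w], which is
    [O(r)] times the offline cost, or the excess of [w] drops by at least [l / 2] (if [w]
    is the fetched element) or [l / r] (if its budget is increased), and this
    pays for everything else. *)

(** * Access cost, position counting and swap distance *)

Lemma access_le (U : finType) (R : {set U}) (pi : listing U) x :
  x \in R -> (access R pi <= pi x)%N.
Proof.
move=> xR; rewrite /access.
have := @bigmin_inf _ _ _ #|U| x (mem R) (pi x) pi xR (lexx _).
by rewrite -minEnat.
Qed.

Lemma access_attained {U : finType} {R : {set U}} (pi : listing U) :
  R != set0 -> exists2 x, x \in R & (pi x <= access R pi)%N.
Proof.
case/set0Pn=> x0 x0R; case: (arg_minnP pi x0R) => x xR x_min.
exists x => //; rewrite /access; elim/big_ind: _ => [|a b|z /x_min //].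
(* The default value [#|U|] of the minimum is harmless, as no position exceeds it. *)
- by case/andP: (listing_bounds pi x).
- by rewrite leq_min => -> ->.
Qed.

(** [sigma] maps the set injectively into [{1, ..., p %/ m}]. *)
Lemma card_pos_scaled_le (U : finType) (sigma : listing U) (m p : nat) :
  (0 < m)%N -> (#|[set y | m * sigma y <= p]| * m <= p)%N.
Proof.
move=> m_gt0; rewrite -leq_divRL // -(size_iota 1 (p %/ m)) cardE.
rewrite -(size_map sigma); apply: uniq_leq_size.
  by rewrite map_inj_uniq ?enum_uniq //; apply: listing_inj.
move=> k /mapP[y]; rewrite mem_enum inE => le_p ->{k}.
rewrite mem_iota add1n ltnS leq_divRL // mulnC le_p andbT.
by case/andP: (listing_bounds sigma y).
Qed.

Lemma dist_le_size (U : finType) (pi : listing U) s :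
  (dist pi (foldl (@adj_swap U) pi s) <= size s)%N.
Proof.
rewrite /dist; case: ex_minnP => k _; apply.
by apply/existsP; exists (in_tuple s).
Qed.

(** Induction on the position of [z]: swap [z] with its predecessor, then fetch it from the
    resulting listing. *)
Lemma fetch_swaps (U : finType) (z : U) (pi : listing U) :
  exists2 s, foldl (@adj_swap U) pi s = fetch_listing z pi
           & size s = (pi z).-1.
Proof.
move def_k: (pi z).-1 => k; elim: k pi def_k => [|k IHk] pi def_k.
  exists [::] => //; apply/val_inj/ffunP => y /=; rewrite ffunE.
  have := listing_bounds pi z; have := listing_bounds pi y.
  by case: eqP => [->|_]; [lia | case: (ltnP (pi y) (pi z)); lia].
have bnd := listing_bounds pi z.
have lt_k : (k < #|U|.-1)%N by lia.
have [|s Es sz] := IHk (adj_swap pi (Ordinal lt_k)).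
  by rewrite /= ffunE /=; do !case: eqP; lia.
exists (Ordinal lt_k :: s); last by rewrite /= sz.
rewrite /= Es; apply/val_inj/ffunP => y; rewrite /= !ffunE /=.
have [//|/eqP yz] := eqVneq y z.
have pz : pi z = k.+2 by lia.
have /eqP/negPf yk : pi y <> k.+2 by rewrite -pz => /listing_inj.
rewrite pz eqxx yk (_ : (k.+2 == k.+1) = false); last by lia.
by have [->|yk1] := eqVneq (pi y) k.+1; do !case: ifP; lia.
Qed.

(** * The potential and its change under fetches *)

Section Potential.

Variables (U : finType) (r : nat) (sigma : listing U).
Hypothesis r_gt0 : (0 < r)%N.

Implicit Types (st : state U) (R : {set U}) (x y z w : U).

Definition excess st z : rat :=
  Num.max 0 (3 * ((st.1 z)%:R - (30 * r * sigma z)%:R) - st.2 z).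

Definition potential st : rat :=
  2 * (\sum_z st.2 z) + 10 * r%:R * (\sum_z excess st z).

Definition budgets_ge0 st := forall z, 0 <= st.2 z.

Lemma excess_ge0 st z : 0 <= excess st z.
Proof. by rewrite /excess le_max lexx. Qed.

Let r10_ge0 : 0 <= 10 * r%:R :> rat.
Proof. by rewrite mulr_ge0. Qed.

Lemma potential_ge0 st : budgets_ge0 st -> 0 <= potential st.
Proof.
move=> b_ge0; rewrite addr_ge0 ?mulr_ge0 ?sumr_ge0 // => z _.
exact: excess_ge0.
Qed.

Lemma fetch_ge0 z st : budgets_ge0 st -> budgets_ge0 (fetch z st).
Proof. by move=> b_ge0 y; rewrite ffunE; case: eqP. Qed.

Lemma excess_fetched z st : excess (fetch z st) z = 0.
Proof.
apply/max_idPl; rewrite !ffunE eqxx.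
have : (1 <= 30 * r * sigma z)%N by have := listing_bounds sigma z; lia.
by rewrite -(ler_nat rat); lra.
Qed.

Lemma excess_fetch_other z st y : budgets_ge0 st -> y != z ->
  excess (fetch z st) y <=
    excess st y + 3 * (30 * r * sigma y <= st.1 z)%N%:R.
Proof.
move=> /(_ y) b_ge0 yz; rewrite {1}/excess !ffunE (negPf yz) ge_max.
have ex0 := excess_ge0 st y.
have : 3 * ((st.1 y)%:R - (30 * r * sigma y)%:R) - st.2 y <= excess st y.
  by rewrite /excess le_max lexx orbT.
case: (leqP (30 * r * sigma y)%N) => /= near; case: ltnP => lt_yz;
  rewrite -?natr1; try by [lra | move=> ?; apply/andP; split; lra].
(* Remaining case: [y] is before [z], but [st.1 z < 30 * r * sigma y]. The new position of [y] is at
   most [st.1 z], so its excess after the fetch is zero. *)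
move=> _; apply/andP; split; first by lra.
have : ((st.1 y).+1 <= 30 * r * sigma y)%N by lia.
by rewrite -(ler_nat rat) -natr1; lra.
Qed.

Lemma potential_fetch z st : budgets_ge0 st ->
  potential (fetch z st) <=
    potential st - 2 * st.2 z - 10 * r%:R * excess st z + (st.1 z)%:R.
Proof.
move=> b_ge0; rewrite /potential.
set n_near := #|[set y | 30 * r * sigma y <= st.1 z]%N|.
have Eb : \sum_y (fetch z st).2 y = \sum_y st.2 y - st.2 z.
  rewrite !(bigD1 z (P := predT)) //= ffunE eqxx add0r addrAC subrr add0r.
  by apply: eq_bigr => y /negPf yz; rewrite ffunE yz.
have Ee : \sum_y excess (fetch z st) y <=
    \sum_y excess st y - excess st z + 3 * n_near%:R.
  rewrite !(bigD1 z (P := predT)) //= excess_fetched add0r.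
  rewrite (addrAC (excess st z)) subrr add0r.
  apply: le_trans (ler_sum _ (fun y yz => excess_fetch_other b_ge0 yz)) _.
  rewrite big_split lerD2l -mulr_sumr ler_pM2l // -natr_sum ler_nat.
  rewrite /n_near -sum1dep_card big_mkcond [leqRHS]big_mkcond /=.
  by apply: leq_sum => y _; case: (y != z); case: (leqP (30 * r * sigma y)%N).
(* The increments add [10 * r * 3 * n_near] to the potential; the factor 30 in [excess] makes this
   at most [st.1 z]. *)
have : (n_near * (30 * r) <= st.1 z)%N by apply: card_pos_scaled_le; lia.
rewrite -(ler_nat rat) !natrM Eb => le_near.
have /(ler_wpM2l r10_ge0) := Ee; lra.
Qed.

(** An eligible [z] has budget at least [st.1 z], so its fetch lowers the potential by at least
    [st.1 z], which covers the swaps. The swaps are kept as one sequence in order to bound the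
    distance over the whole step. *)
Lemma potential_loop st st' : budgets_ge0 st -> dlm_loop st st' ->
  [/\ budgets_ge0 st', forall z, st'.2 z < (st'.1 z)%:R
    & exists2 s, foldl (@adj_swap U) st.1 s = st'.1
               & (size s)%:R + potential st' <= potential st].
Proof.
move=> b_ge0 run; elim: run b_ge0 => {st st'} [st done|st st' z elig _ IH] b_ge0.
  by split=> //; exists [::]; rewrite ?add0r.
have [b'_ge0 lt_b' [s Es le_s]] := IH (fetch_ge0 z b_ge0).
split=> //; have [s0 Es0 sz0] := fetch_swaps z st.1.
exists (s0 ++ s); first by rewrite foldl_cat Es0.
have : (size s0 <= st.1 z)%N by rewrite sz0 leq_pred.
rewrite size_cat natrD -(ler_nat rat) => le_s0.
have ex := mulr_ge0 r10_ge0 (excess_ge0 st z).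
by have := potential_fetch z b_ge0; lra.
Qed.

(** * Effect of charging the budgets *)

Lemma charge_ge R x l st y : st.2 y <= (charge R x l st).2 y.
Proof. by rewrite ffunE; case: ifP => // _; rewrite lerDl divr_ge0. Qed.

Lemma excess_charge R x l st y : excess (charge R x l st) y <= excess st y.
Proof.
rewrite /excess ge_max !le_max lexx /=; apply/orP; right.
by rewrite lerD2l lerN2 charge_ge.
Qed.

Lemma excess_charged R x l st w : w \in R -> w != x ->
  l%:R / #|R|%:R <= excess st w ->
  excess (charge R x l st) w <= excess st w - l%:R / #|R|%:R.
Proof.
move=> wR wx le_ex; rewrite {1}/excess ge_max subr_ge0 le_ex /=.
rewrite ffunE !inE wR wx /= opprD addrA lerD2r.
by rewrite /excess le_max lexx orbT.
Qed.

Lemma sum_budget_charge R x l st : x \in R ->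
  \sum_y (charge R x l st).2 y <= \sum_y st.2 y + l%:R.
Proof.
move=> xR; have R_gt0 : (0 < #|R|)%N by apply/card_gt0P; exists x.
have -> : \sum_y (charge R x l st).2 y =
    \sum_y st.2 y + \sum_(y in R :\ x) (l%:R / #|R|%:R).
  rewrite [X in _ + X]big_mkcond -big_split; apply: eq_bigr => y _.
  by rewrite ffunE /=; case: ifP; rewrite ?addr0.
rewrite lerD2l sumr_const -(mulr_natr (_ / _)) mulrAC ler_pdivrMr ?ltr0n //.
by rewrite ler_wpM2l // ler_nat subset_leq_card // subD1set.
Qed.

Lemma potential_charge R x l st : x \in R ->
  potential (charge R x l st) <= potential st + 2 * l%:R.
Proof.
move=> xR; have := sum_budget_charge l st xR.
have : 10 * r%:R * (\sum_y excess (charge R x l st) y) <=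
    10 * r%:R * (\sum_y excess st y).
  by rewrite ler_wpM2l //; apply: ler_sum => y _; apply: excess_charge.
by rewrite /potential; lra.
Qed.

(** The excess of [w] drops by [l / #|R|], which with weight [10 * r] is worth at least [10 * l]
    since [#|R| <= r]. The budgets give back at most [2 * l]. *)
Lemma potential_charge_drop R x l st w : x \in R -> w \in R -> w != x ->
  (#|R| <= r)%N -> l%:R / #|R|%:R <= excess st w ->
  potential (charge R x l st) <= potential st - 8 * l%:R.
Proof.
move=> xR wR wx R_le le_ex; have := sum_budget_charge l st xR.
have R_gt0 : (0 < #|R|)%N by apply/card_gt0P; exists x.
have le_sum : \sum_y excess (charge R x l st) y <=
    \sum_y excess st y - l%:R / #|R|%:R.
  rewrite !(bigD1 w (P := predT)) //= addrAC lerD ?excess_charged //.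
  by apply: ler_sum => y _; apply: excess_charge.
have /(ler_wpM2l r10_ge0) := le_sum.
have : l%:R <= r%:R * (l%:R / #|R|%:R) :> rat.
  by rewrite mulrCA ler_peMr // ler_pdivlMr ?ltr0n // mul1r ler_nat.
by rewrite /potential; lra.
Qed.

(** * Amortized cost of one request *)

Lemma excess_ge_half st z : st.2 z < (st.1 z)%:R ->
  60 * r%:R * (sigma z)%:R < (st.1 z)%:R :> rat ->
  (st.1 z)%:R / 2 <= excess st z.
Proof.
move=> b_lt far; rewrite /excess le_max !natrM; apply/orP; right.
by lra.
Qed.

Lemma potential_request R st x w : budgets_ge0 st ->
  (forall z, st.2 z < (st.1 z)%:R) -> (#|R| <= r)%N -> x \in R ->
  (forall y, y \in R -> (st.1 x <= st.1 y)%N) -> w \in R ->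
  2 * (st.1 x)%:R + potential (charge R x (st.1 x) (fetch x st)) <=
    300 * r%:R * (sigma w)%:R + potential st.
Proof.
move=> b_ge0 b_lt R_le xR x_min wR.
have fetch_le : potential (fetch x st) <=
    potential st - 10 * r%:R * excess st x + (st.1 x)%:R.
  by have := b_ge0 x; have := potential_fetch x b_ge0; lra.
have charge_le := potential_charge (st.1 x) (fetch x st) xR.
have ex := mulr_ge0 r10_ge0 (excess_ge0 st x).
have rw_ge0 : 0 <= r%:R * (sigma w)%:R :> rat.
  by apply: mulr_ge0; exact: ler0n.
have [close|far] := lerP (st.1 x)%:R (60 * r%:R * (sigma w)%:R : rat).
  (* With [l = st.1 x]: cost [2 * l], fetch [l] and charge [2 * l] add up to [5 * l], and
     [5 * 60 = 300]. *)
  by clear -fetch_le charge_le ex close; lra.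
have [E|wx] := eqVneq w x.
  have {}ex : 5 * (st.1 x)%:R <= 10 * r%:R * excess st x.
    rewrite E in far; have ge_half := excess_ge_half (b_lt x) far.
    apply: le_trans (ler_wpM2l r10_ge0 ge_half).
    rewrite mulrA; have : (st.1 x)%:R <= r%:R * (st.1 x)%:R :> rat.
      by apply: ler_peMl; [exact: ler0n | rewrite ler1n; exact: r_gt0].
    by clear; lra.
  by clear -fetch_le charge_le ex rw_ge0; lra.
(* [w] lies behind [x], so fetching [x] does not move it. *)
have Ew : (fetch x st).1 w = st.1 w.
  by rewrite ffunE (negPf wx) ltnNge (x_min _ wR).
have lw : (st.1 x)%:R <= (st.1 w)%:R :> rat by rewrite ler_nat x_min.
have drop : (st.1 x)%:R / #|R|%:R <= excess (fetch x st) w.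
  have b_lt_w : (fetch x st).2 w < ((fetch x st).1 w)%:R.
    by rewrite Ew ffunE (negPf wx); exact: b_lt.
  have far_w : 60 * r%:R * (sigma w)%:R < ((fetch x st).1 w)%:R :> rat.
    by rewrite Ew; exact: lt_le_trans far lw.
  have ge_half := excess_ge_half b_lt_w far_w; rewrite Ew in ge_half.
  (* Two distinct requested elements make the charge at most [l / 2], within the excess of [w]. *)
  have R_ge2 : (1 < #|R|)%N by apply/card_gt1P; exists w, x; split.
  apply: le_trans ge_half; apply: ler_pM lw _; first exact: ler0n.
    by rewrite invr_ge0; exact: ler0n.
  by clear -R_ge2; rewrite lef_pV2 ?posrE ?ltr0n ?(ler_nat _ 2) // ltnW.
have {drop}:= potential_charge_drop xR wR wx R_le drop.
have l_ge0 : 0 <= (st.1 x)%:R :> rat by exact: ler0n.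
by clear -fetch_le ex rw_ge0 l_ge0; lra.
Qed.

Lemma potential_step R st st' : budgets_ge0 st ->
  (forall z, st.2 z < (st.1 z)%:R) -> (#|R| <= r)%N -> dlm_step st R st' ->
  [/\ budgets_ge0 st', forall z, st'.2 z < (st'.1 z)%:R
    & (access R st.1 + dist st.1 st'.1)%:R + potential st' <=
        300 * r%:R * (access R sigma)%:R + potential st].
Proof.
move=> b_ge0 b_lt R_le [x [xR x_min run]].
have c_ge0 : budgets_ge0 (charge R x (st.1 x) (fetch x st)).
  by move=> y; apply: le_trans (charge_ge _ _ _ _ _); apply: fetch_ge0.
have [b'_ge0 b'_lt [s Es le_s]] := potential_loop c_ge0 run.
split; [exact: b'_ge0 | exact: b'_lt |].
have [w wR w_le] : exists2 w, w \in R & (sigma w <= access R sigma)%N.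
  by apply: access_attained; apply/set0Pn; exists x.
have le_req := potential_request b_ge0 b_lt R_le xR x_min wR.
have le_opt : r%:R * (sigma w)%:R <= r%:R * (access R sigma)%:R :> rat.
  by apply: ler_wpM2l; rewrite ?ler_nat ?ler0n.
have [s0 Es0 sz0] := fetch_swaps x st.1.
(* One [st.1 x] is for the access, the other for the swaps [s0] of the first fetch; [s] holds the
   swaps of the loop. *)
have le_cost : (access R st.1 + dist st.1 st'.1 <= 2 * st.1 x + size s)%N.
  have := dist_le_size st.1 (s0 ++ s); rewrite foldl_cat Es0 Es size_cat sz0.
  by have := access_le st.1 xR; clear; lia.
have {}le_cost : (access R st.1 + dist st.1 st'.1)%:R <=
    2 * (st.1 x)%:R + (size s)%:R :> rat.
  by rewrite -natrM -natrD ler_nat; exact: le_cost.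
by clear -le_s le_req le_opt le_cost; lra.
Qed.

(** * Summation over the run and the additive constant *)

Lemma potential_run st Rs pis : budgets_ge0 st ->
  (forall z, st.2 z < (st.1 z)%:R) -> (forall R, R \in Rs -> (#|R| <= r)%N) ->
  dlm_run st Rs pis ->
  (total_cost st.1 Rs pis)%:R <=
    300 * r%:R * (static_cost sigma Rs)%:R + potential st.
Proof.
move=> b_ge0 b_lt R_le run; elim: run b_ge0 b_lt R_le => {st Rs pis}.
  by move=> st b_ge0 _ _; rewrite /static_cost big_nil mulr0 add0r potential_ge0.
move=> st st' R Rs pis step _ IH b_ge0 b_lt R_le.
have [b'_ge0 b'_lt le_step] :=
  potential_step b_ge0 b_lt (R_le R (mem_head R Rs)) step.
have := IH b'_ge0 b'_lt (fun R' R'Rs => R_le R' (@mem_behead _ (R :: Rs) R' R'Rs)).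
by rewrite /static_cost big_cons /= !natrD in le_step *; lra.
Qed.

Lemma potential_init pi0 :
  potential (dlm_init pi0) <= 30 * r%:R * \sum_z (pi0 z)%:R.
Proof.
rewrite /potential big1 ?mulr0 ?add0r => [|z _]; last by rewrite ffunE.
rewrite [30 * _](_ : _ = 10 * r%:R * 3); last by lra.
rewrite -[leRHS]mulrA ler_wpM2l ?mulr_ge0 // mulr_sumr; apply: ler_sum => z _.
rewrite /excess ge_max mulr_ge0 //= ffunE subr0 ler_pM2l //.
by rewrite gerBl.
Qed.

End Potential.

Theorem theorem10 :
  exists2 C : rat, 0 < C &
    forall (n r : nat) (U : finType),
      (0 < n)%N -> (0 < r)%N -> #|U| = n ->
    forall pi0 : listing U,
    exists xi : rat,
    forall (Rs : seq {set U}) (pis : seq (listing U)) (sigma : listing U),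
      (forall R, R \in Rs -> (R != set0) && (#|R| <= r)%N) ->
      dlm_run (dlm_init pi0) Rs pis ->
      (total_cost pi0 Rs pis)%:R <= C * r%:R * (static_cost sigma Rs)%:R + xi.
Proof.
(* The initial potential depends on [sigma], which is quantified after [xi]; hence a bound on it
   uniform in [sigma] is taken. *)
exists 300 => // n r U _ r_gt0 _ pi0; exists (30 * r%:R * \sum_z (pi0 z)%:R).
move=> Rs pis sigma ok run.
have b_ge0 : budgets_ge0 (dlm_init pi0) by move=> z; rewrite ffunE.
have b_lt z : (dlm_init pi0).2 z < (pi0 z)%:R.
  by rewrite ffunE ltr0n; case/andP: (listing_bounds pi0 z).
have R_le R : R \in Rs -> (#|R| <= r)%N by case/ok/andP.
apply: le_trans (potential_run sigma r_gt0 b_ge0 b_lt R_le run) _.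
by rewrite lerD2l; exact: potential_init.
Qed.
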